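(* Let $q$ be a non-zero complex number. Let $r\geq 3$ be an odd integer, let $A_1,\dots,A_r\in\{\alpha_1,\alpha_2,\alpha_1\alpha_2,\alpha_2\alpha_1,\alpha_1\alpha_2\alpha_1\}$ be such that $\sum_{i=1}^r\mathrm{length}(A_i)$ is even, and let $x\in C_3$ be $$x=A_1TA_2T\cdots A_{r-1}TA_rT^{1-r}\quad\text{or}\quad x=T^{1-r}A_1TA_2T\cdots A_{r-1}TA_r.$$ Suppose one of the following holds: (a) $A_rA_1=A_2=A_3=\cdots=A_{r-1}$. (b) $A_rA_1=A_{r-1}A_2=\cdots=A_{\frac{r+3}{2}}A_{\frac{r-1}{2}}=1$. (c) There exists $i\in\{0,1,2,\ldots,\frac{r-5}{2}\}$ such that $A_rA_1=A_{r-1}A_2=\cdots=A_{r-i}A_{i+1}=1$ and $A_{r-i-1}A_{i+2}=A_{i+3}=A_{i+4}=\cdots=A_{r-i-2}$. Then there exist $w\in C_3$, $A\in\{\alpha_1,\alpha_2,\alpha_1\alpha_2,\alpha_2\alpha_1,\alpha_1\alpha_2\alpha_1\}$ and an integer $s\geq 1$ such that $$\rho(w^{-1}xw)=\rho\big((AT)^sT^{-s}\big).$$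
   Context: $C_3$ is the group of conjugating automorphisms of the free group $\mathbb{F}_3=\langle x_1,x_2,x_3\rangle$, i.e. the subgroup of $\mathrm{Aut}(\mathbb{F}_3)$ of those $\phi$ with $\phi(x_i)=f_i^{-1}x_{\Pi(i)}f_i$ for a permutation $\Pi$ of $\{1,2,3\}$ and some $f_i\in\mathbb{F}_3$. It is presented by generators $\sigma_1,\sigma_2,\alpha_1,\alpha_2$ and relations $\sigma_1\sigma_2\sigma_1=\sigma_2\sigma_1\sigma_2$, $\alpha_1^2=\alpha_2^2=1$, $\alpha_1\alpha_2\alpha_1=\alpha_2\alpha_1\alpha_2$, $\sigma_1\alpha_2\alpha_1=\alpha_2\alpha_1\sigma_2$, $\sigma_2\sigma_1\alpha_2=\alpha_1\sigma_2\sigma_1$. For a fixed non-zero complex number $q$, the representation $\rho:C_3\to GL_3(\mathbb{C})$ is the homomorphism given by $$\rho(\sigma_1)=\begin{pmatrix} q^2&0&0\\ q(q-1)&1-q&q\\ 0&1&0\end{pmatrix},\quad \rho(\sigma_2)=\begin{pmatrix}1-q&q&q(q-1)\\1&0&0\\0&0&q^2\end{pmatrix},$$ $$\rho(\alpha_1)=\begin{pmatrix}1&0&0\\0&0&1\\0&1&0\end{pmatrix},\quad \rho(\alpha_2)=\begin{pmatrix}0&1&0\\1&0&0\\0&0&1\end{pmatrix}.$$ $T=\sigma_2\alpha_2\alpha_1\in C_3$. The length of a word is the sum of the absolute values of the exponents of the generators in it; thus $\alpha_1,\alpha_2$ have length $1$, $\alpha_1\alpha_2,\alpha_2\alpha_1$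 have length $2$, and $\alpha_1\alpha_2\alpha_1$ has length $3$. All equalities between products of the $A_i$ are equalities in $C_3$. For $r=3$ the index set in (c) is empty, so (c) does not occur. *)

(* Defs.v *)
From HB Require Import structures.
Set Warnings "-notation-overridden,-ambiguous-paths".
From mathcomp Require Import all_boot all_fingroup all_algebra.
From mathcomp Require Import ring boolp reals.
From mathcomp.real_closed Require Import complex.

Set Implicit Arguments.
Unset Strict Implicit.
Unset Printing Implicit Defensive.

Import GRing.Theory.
Local Open Scope group_scope.

(* (i, false) stands for x_i and (i, true) for x_i^-1. *)
Notation letter n := ('I_n * bool)%type.

Definition linv n (l : letter n) : letter n := (l.1, ~~ l.2).

Definition reduced n (w : seq (letter n)) : bool :=
  sorted (fun l l' => l' != linv l) w.

Record FreeGroup (n : nat) :=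
  RedWord { fg_word : seq (letter n); fg_wordP : reduced fg_word }.
HB.instance Definition _ n := [isSub for @fg_word n].
HB.instance Definition _ n := [Choice of FreeGroup n by <:].

Definition push n (l : letter n) (w : seq (letter n)) : seq (letter n) :=
  if w is l' :: w' then if l' == linv l then w' else l :: w else [:: l].

Lemma linvK n : involutive (@linv n).
Proof. by case=> i b; rewrite /linv /= negbK. Qed.

Lemma push_reduced n (l : letter n) w : reduced w -> reduced (push l w).
Proof.
case: w => [|l' w] //= red_w; case: ifPn => [_|l'l /=].
  exact: path_sorted red_w.
by rewrite l'l.
Qed.

Lemma pushes_reduced n (u w : seq (letter n)) :
  reduced w -> reduced (foldr (@push n) w u).
Proof. by move=> red_w; elim: u => //= l u; apply: push_reduced. Qed.

Lemma pushK n (l : letter n) w : reduced w -> push (linv l) (push l w) = w.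
Proof.
case: w => [|l' w] red_w /=; first by rewrite linvK eqxx.
have [l'l|_] := eqVneq l' (linv l) => /=; last by rewrite linvK eqxx.
case: w red_w => [|k w] /=; first by rewrite l'l.
by case/andP; rewrite -l'l => /negPf->.
Qed.

Lemma pushVK n (l : letter n) w : reduced w -> push l (push (linv l) w) = w.
Proof. by move=> red_w; rewrite -{1}[l]linvK pushK. Qed.

Lemma pushes_nil n (u : seq (letter n)) :
  reduced u -> foldr (@push n) [::] u = u.
Proof.
elim: u => //= l [|k u] IHu //= /andP[kl red_u].
by rewrite [push k _]IHu //= (negPf kl).
Qed.

Lemma pushesA n (u v w : seq (letter n)) : reduced w ->
  foldr (@push n) (foldr (@push n) w v) u
  = foldr (@push n) w (foldr (@push n) v u).
Proof.
move=> red_w; elim: u => //= l u ->.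
case: (foldr _ v u) => [|k t] //=; case: eqP => //= ->.
by rewrite pushVK // pushes_reduced.
Qed.

Lemma pushesV n (u w : seq (letter n)) : reduced w ->
  foldr (@push n) (foldr (@push n) w u) (rev (map (@linv n) u)) = w.
Proof.
move=> red_w; elim: u => //= l u IHu.
by rewrite rev_cons foldr_rcons pushK ?pushes_reduced.
Qed.

Lemma linvs_reduced n (u : seq (letter n)) :
  reduced u -> reduced (rev (map (@linv n) u)).
Proof.
rewrite /reduced rev_sorted sorted_map; apply: sub_sorted => l k /=.
by apply: contraNneq => ->; rewrite linvK.
Qed.

Definition fg_one n : FreeGroup n := @RedWord n [::] isT.
Definition fg_mul n (u v : FreeGroup n) : FreeGroup n :=
  RedWord (pushes_reduced (val u) (valP v)).
Definition fg_inv n (u : FreeGroup n) : FreeGroup n :=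
  RedWord (linvs_reduced (valP u)).

Lemma fg_mulA n : associative (@fg_mul n).
Proof. by move=> u v w; apply: val_inj; rewrite /= pushesA ?(valP w). Qed.
Lemma fg_mul1 n : left_id (@fg_one n) (@fg_mul n).
Proof. by move=> u; apply: val_inj. Qed.
Lemma fg_mulr1 n : right_id (@fg_one n) (@fg_mul n).
Proof. by move=> u; apply: val_inj; rewrite /= pushes_nil ?(valP u). Qed.
Lemma fg_mulV n : left_inverse (@fg_one n) (@fg_inv n) (@fg_mul n).
Proof.
move=> u; apply: val_inj => /=.
by rewrite -{1}(pushes_nil (valP u)) pushesV.
Qed.
Lemma fg_invK n : involutive (@fg_inv n).
Proof.
move=> u; apply: val_inj => /=.
by rewrite map_rev revK (mapK (@linvK n)).
Qed.
Lemma fg_mulrV n : right_inverse (@fg_one n) (@fg_inv n) (@fg_mul n).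
Proof. by move=> u; rewrite -{1}(fg_invK u) fg_mulV. Qed.

HB.instance Definition _ n := isGroup.Build (FreeGroup n)
  (@fg_mulA n) (@fg_mul1 n) (@fg_mulr1 n) (@fg_mulV n) (@fg_mulrV n).

Definition fgen n (i : 'I_n) : FreeGroup n := @RedWord n [:: (i, false)] isT.

Definition fg_lift n (G : groupType) (g : 'I_n -> G) (w : FreeGroup n) : G :=
  \big[*%g/1]_(l <- val w) (if l.2 then (g l.1)^-1 else g l.1).

Lemma fg_liftM n (G : groupType) (g : 'I_n -> G) :
  {morph fg_lift g : u v / u * v}.
Proof.
move=> [u ru] [v rv]; rewrite /fg_lift /= => {ru rv}.
elim: u => [|l u IHu] /=; first by rewrite big_nil mul1g.
rewrite big_cons -mulgA -IHu; case: (foldr _ v u) => [|k t] /=.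
  by rewrite big_seq1 big_nil mulg1.
case: eqP => [->|_]; rewrite !big_cons //.
by case: l => i [] /=; rewrite ?mulKg ?mulVKg.
Qed.

Lemma fg_lift_gen n (G : groupType) (g : 'I_n -> G) i :
  fg_lift g (fgen i) = g i.
Proof. by rewrite /fg_lift big_seq1. Qed.

Lemma morph_group1 (G H : groupType) (f : G -> H) :
  {morph f : u v / u * v} -> f 1 = 1.
Proof. by move=> fM; apply: (mulgI (f 1)); rewrite -fM !mulg1. Qed.

Lemma morph_groupV (G H : groupType) (f : G -> H) :
  {morph f : u v / u * v} -> {morph f : u / u^-1}.
Proof.
move=> fM u; apply: (mulgI (f u)).
by rewrite -fM !mulgV (morph_group1 fM).
Qed.

Lemma fg_ind n (P : FreeGroup n -> Prop) :
  P 1 ->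
  (forall i (b : bool) u, P u -> P ((if b then (fgen i)^-1 else fgen i) * u)) ->
  forall u, P u.
Proof.
move=> P1 PM [u ru]; elim: u ru => [|[i b] u IHu] ru.
  by have -> : RedWord ru = 1 :> FreeGroup n by apply: val_inj.
have ru' : reduced u by apply: path_sorted ru.
have -> : RedWord ru = (if b then (fgen i)^-1 else fgen i) * RedWord ru'.
  apply: val_inj; case: b ru => /=; case: (u) => [|k t] //= /andP[/negPf kl _];
  by rewrite [_ == _]kl.
exact: PM.
Qed.

Lemma fg_ext n (G : groupType) (f h : FreeGroup n -> G) :
  {morph f : u v / u * v} -> {morph h : u v / u * v} ->
  (forall i, f (fgen i) = h (fgen i)) -> f =1 h.
Proof.
move=> fM hM fh; apply: fg_ind => [|i b u IHu].
  by rewrite (morph_group1 fM) (morph_group1 hM).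
rewrite fM hM IHu; congr (_ * _); case: b => //.
by rewrite (morph_groupV fM) (morph_groupV hM) fh.
Qed.

Definition is_aut (G : groupType) (f : G -> G) : bool :=
  `[< bijective f /\ {morph f : u v / u * v} >].

Record AutGroup (G : groupType) :=
  Automorphism { aut_fun :> G -> G; aut_funP : is_aut aut_fun }.
HB.instance Definition _ G := [isSub for @aut_fun G].
HB.instance Definition _ G := [Choice of AutGroup G by <:].

Lemma autP (G : groupType) (f : AutGroup G) :
  bijective (val f) /\ {morph val f : u v / u * v}.
Proof. exact/asboolP/(valP f). Qed.

Lemma id_is_aut (G : groupType) : is_aut (@id G).
Proof. by apply/asboolP; split; first exists id. Qed.

Lemma comp_is_aut (G : groupType) (f h : AutGroup G) :
  is_aut (val f \o val h).
Proof.
have [[fB fM] [hB hM]] := (autP f, autP h).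
by apply/asboolP; split=> [|u v /=]; [exact: bij_comp | rewrite hM fM].
Qed.

Lemma inv_aut_ex (G : groupType) (f : AutGroup G) :
  exists h : AutGroup G, cancel (val f) (val h) /\ cancel (val h) (val f).
Proof.
have [[h fK hK] fM] := autP f.
have hA : is_aut h.
  apply/asboolP; split=> [|u v]; first by exists (val f).
  by apply: (can_inj fK); rewrite fM !hK.
by exists (Automorphism hA).
Qed.

(* The product is composition: (f * h)(u) = f (h u). *)
Definition aut_one G : AutGroup G := Automorphism (id_is_aut G).
Definition aut_mul G (f h : AutGroup G) : AutGroup G :=
  Automorphism (comp_is_aut f h).
Definition aut_inv G (f : AutGroup G) : AutGroup G := sval (cid (inv_aut_ex f)).

Lemma aut_mulA G : associative (@aut_mul G).
Proof. by move=> f g h; apply: val_inj. Qed.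
Lemma aut_mul1 G : left_id (@aut_one G) (@aut_mul G).
Proof. by move=> f; apply: val_inj. Qed.
Lemma aut_mulr1 G : right_id (@aut_one G) (@aut_mul G).
Proof. by move=> f; apply: val_inj. Qed.
Lemma aut_mulV G : left_inverse (@aut_one G) (@aut_inv G) (@aut_mul G).
Proof.
move=> f; apply: val_inj; apply: funext => u /=.
by rewrite /aut_inv; case: cid => h [fK hK] /=; rewrite fK.
Qed.
Lemma aut_mulrV G : right_inverse (@aut_one G) (@aut_inv G) (@aut_mul G).
Proof.
move=> f; apply: val_inj; apply: funext => u /=.
by rewrite /aut_inv; case: cid => h [fK hK] /=; rewrite hK.
Qed.

HB.instance Definition _ G := isGroup.Build (AutGroup G)
  (@aut_mulA G) (@aut_mul1 G) (@aut_mulr1 G) (@aut_mulV G) (@aut_mulrV G).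

Lemma aut_ext n (f h : AutGroup (FreeGroup n)) :
  (forall i, val f (fgen i) = val h (fgen i)) -> f = h.
Proof.
move=> fh; apply: val_inj; apply: funext.
by apply: fg_ext fh; [case: (autP f) | case: (autP h)].
Qed.

Definition conjugating n : {pred AutGroup (FreeGroup n)} :=
  fun phi => `[< exists (p : 'S_n) (f : 'I_n -> FreeGroup n),
    forall i, val phi (fgen i) = (f i)^-1 * fgen (p i) * f i >].
Arguments conjugating n : clear implicits.

Lemma conjugating_group_closed n : group_closed (conjugating n).
Proof.
split=> [|phi psi /asboolP[p [f phiE]] /asboolP[s [g psiE]]].
  apply/asboolP; exists 1, (fun=> 1) => i /=.
  by rewrite perm1 invg1 mul1g mulg1.
have [[_ phiM] [_ psiM]] := (autP phi, autP psi).
have [_ psiVM] := autP psi^-1.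
have psiVE i : val psi^-1 (fgen i)
    = val psi^-1 (g (s^-1 i)%g) * fgen (s^-1 i)%g * (val psi^-1 (g (s^-1 i)%g))^-1.
  have psiK v : val psi^-1 (val psi v) = v.
    by rewrite -[LHS]/(val (psi^-1 * psi) v) mulVg.
  have /(congr1 (val psi^-1)) := psiE (s^-1 i)%g.
  rewrite psiK permKV !psiVM (morph_groupV psiVM) => ->.
  by rewrite !mulgA mulgV mul1g mulgK.
pose j i := (s^-1 i)%g.
apply/asboolP; exists (s^-1 * p)%g.
exists (fun i => f (j i) * (val phi (val psi^-1 (g (j i))))^-1) => i.
rewrite -[LHS]/(val phi (val psi^-1 (fgen i))) psiVE !phiM (morph_groupV phiM).
by rewrite phiE permM invgM invgK !mulgA.
Qed.

Record ConjAut (n : nat) := ConjugatingAut {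
  conj_aut :> AutGroup (FreeGroup n);
  conj_autP : conj_aut \in conjugating n
}.
HB.instance Definition _ n := [isSub for @conj_aut n].
HB.instance Definition _ n := [Choice of ConjAut n by <:].
HB.instance Definition _ n :=
  SubChoice_isSubGroup.Build _ _ (ConjAut n) (@conjugating_group_closed n).

Notation C3 := (ConjAut 3).

Lemma fg_lift_aut n (g h : 'I_n -> FreeGroup n) :
  (forall k, fg_lift g (h k) = fgen k) -> (forall k, fg_lift h (g k) = fgen k) ->
  is_aut (fg_lift g).
Proof.
move=> gh hg; apply/asboolP; split; last exact: fg_liftM.
by exists (fg_lift h); apply: (fg_ext (h := id)) => // [u v|k];
  rewrite ?fg_liftM ?fg_lift_gen.
Qed.

Definition sigma_img n (i j k : 'I_n) : FreeGroup n :=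
  if k == i then fgen j
  else if k == j then (fgen j)^-1 * fgen i * fgen j else fgen k.

Definition alpha_img n (i j k : 'I_n) : FreeGroup n := fgen (tperm i j k).

Lemma sigma_is_aut n (i j : 'I_n) : is_aut (fg_lift (sigma_img i j)).
Proof.
pose h k := if k == j then fgen i
  else if k == i then fgen i * fgen j * (fgen i)^-1 else fgen k.
have liftV (f : 'I_n -> FreeGroup n) := morph_groupV (fg_liftM f).
apply: (fg_lift_aut (h := h)) => k; rewrite /h /sigma_img.
  have [->|kj] := eqVneq k j; first by rewrite fg_lift_gen eqxx.
  have [->|ki] := eqVneq k i; last by rewrite fg_lift_gen (negPf ki) (negPf kj).
  rewrite !fg_liftM liftV !fg_lift_gen eqxx eq_sym; case: eqP => [->|_].
    by rewrite mulgK.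
  by rewrite eqxx !mulgA mulgV mul1g mulgK.
have [->|ki] := eqVneq k i; first by rewrite fg_lift_gen eqxx.
have [->|kj] := eqVneq k j; last by rewrite fg_lift_gen (negPf ki) (negPf kj).
rewrite !fg_liftM liftV !fg_lift_gen eqxx; case: eqP => [->|_].
  by rewrite mulVg mul1g.
by rewrite eqxx !mulgA mulVg mul1g mulgKV.
Qed.

Lemma alpha_is_aut n (i j : 'I_n) : is_aut (fg_lift (alpha_img i j)).
Proof.
by apply: (fg_lift_aut (h := alpha_img i j)) => k;
  rewrite fg_lift_gen /alpha_img tpermK.
Qed.

Lemma sigma_conjugating n (i j : 'I_n) :
  Automorphism (sigma_is_aut i j) \in conjugating n.
Proof.
apply/asboolP; exists (tperm i j), (fun k => if k == j then fgen j else 1) => k.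
rewrite /= fg_lift_gen /sigma_img.
have [->|ki] := eqVneq k i.
  rewrite tpermL; case: eqP => [_|_]; first by rewrite mulVg mul1g.
  by rewrite invg1 mul1g mulg1.
have [->|kj] := eqVneq k j; first by rewrite tpermR.
by rewrite tpermD 1?eq_sym // invg1 mul1g mulg1.
Qed.

Lemma alpha_conjugating n (i j : 'I_n) :
  Automorphism (alpha_is_aut i j) \in conjugating n.
Proof.
apply/asboolP; exists (tperm i j), (fun=> 1) => k.
by rewrite /= fg_lift_gen invg1 mul1g mulg1.
Qed.

(* x_i |-> x_j, x_j |-> x_j^-1 x_i x_j, the other generators being fixed.  Of
   the two usual normalizations of sigma (this one and its inverse), this is
   the one that satisfies sigma2 sigma1 alpha2 = alpha1 sigma2 sigma1 when the
   product is composition of maps: see C3_relations. *)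
Definition sigma n (i j : 'I_n) : ConjAut n :=
  ConjugatingAut (sigma_conjugating i j).

Definition alpha n (i j : 'I_n) : ConjAut n :=
  ConjugatingAut (alpha_conjugating i j).

Notation ord3_0 := (@Ordinal 3 0 isT).
Notation ord3_1 := (@Ordinal 3 1 isT).
Notation ord3_2 := (@Ordinal 3 2 isT).

Definition sigma1 : C3 := sigma ord3_0 ord3_1.
Definition sigma2 : C3 := sigma ord3_1 ord3_2.
Definition alpha1 : C3 := alpha ord3_0 ord3_1.
Definition alpha2 : C3 := alpha ord3_1 ord3_2.

Lemma conj_aut_ext n (f h : ConjAut n) :
  (forall i, val (val f) (fgen i) = val (val h) (fgen i)) -> f = h.
Proof. by move=> fh; apply: val_inj; apply: aut_ext. Qed.

Lemma sigma_imgE n (i j k : 'I_n) : sigma_img i j k =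
  if k == i then fgen j
  else if k == j then (fgen j)^-1 * fgen i * fgen j else fgen k.
Proof. by []. Qed.

Lemma alpha_imgE n (i j k : 'I_n) : alpha_img i j k =
  if k == i then fgen j else if k == j then fgen i else fgen k.
Proof.
rewrite /alpha_img; have [->|ki] := eqVneq k i; first by rewrite tpermL.
have [->|kj] := eqVneq k j; first by rewrite tpermR.
by rewrite tpermD // eq_sym.
Qed.

Lemma C3_relations :
  [/\ sigma1 * sigma2 * sigma1 = sigma2 * sigma1 * sigma2,
      alpha1 * alpha1 = 1 /\ alpha2 * alpha2 = 1,
      alpha1 * alpha2 * alpha1 = alpha2 * alpha1 * alpha2,
      sigma1 * alpha2 * alpha1 = alpha2 * alpha1 * sigma2
    & sigma2 * sigma1 * alpha2 = alpha1 * sigma2 * sigma1].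
Proof.
have liftV (f : 'I_3 -> FreeGroup 3) := morph_groupV (fg_liftM f).
split; [|split|..]; apply: conj_aut_ext => -[[|[|[|//]]] lti] /=;
  rewrite (bool_irrelevance lti isT) => {lti};
  repeat rewrite !(fg_liftM, liftV, fg_lift_gen, sigma_imgE, alpha_imgE) /=;
  exact: val_inj.
Qed.

Definition T : C3 := sigma2 * alpha2 * alpha1.

Inductive C3gen := Sigma1 | Sigma2 | Alpha1 | Alpha2.

Definition C3gen_val (g : C3gen) : C3 :=
  match g with
  | Sigma1 => sigma1 | Sigma2 => sigma2 | Alpha1 => alpha1 | Alpha2 => alpha2
  end.

Definition word := seq (C3gen * int).

Definition zexpg (G : groupType) (x : G) (m : int) : G :=
  match m with Posz k => x ^+ k | Negz k => x ^- k.+1 end.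

Definition word_val (w : word) : C3 :=
  \big[*%g/1]_(l <- w) zexpg (C3gen_val l.1) l.2.

Definition word_length (w : word) : nat := (\sum_(l <- w) `|l.2|)%N.

Definition alpha_word (w : word) : Prop :=
     w = [:: (Alpha1, 1%R)]
  \/ w = [:: (Alpha2, 1%R)]
  \/ w = [:: (Alpha1, 1%R); (Alpha2, 1%R)]
  \/ w = [:: (Alpha2, 1%R); (Alpha1, 1%R)]
  \/ w = [:: (Alpha1, 1%R); (Alpha2, 1%R); (Alpha1, 1%R)].

Definition mx3 (F : fieldType) (rows : seq (seq F)) : 'M[F]_3 :=
  (\matrix_(i, j) nth 0 (nth [::] rows i) j)%R.

(* As rho is defined on a group, the first two conditions force its values to
   be invertible: rho is a homomorphism to GL_3. *)
Definition is_rho (F : fieldType) (q : F) (rho : C3 -> 'M[F]_3) : Prop :=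
  [/\ rho 1 = 1%:M%R, {morph rho : x y / x * y >-> (x *m y)%R},
      rho sigma1 = (mx3 [:: [:: q ^+ 2;       0;     0];
                            [:: q * (q - 1);  1 - q; q];
                            [:: 0;            1;     0]])%R,
      rho sigma2 = (mx3 [:: [:: 1 - q; q; q * (q - 1)];
                            [:: 1;     0; 0];
                            [:: 0;     0; q ^+ 2]])%R
    & rho alpha1 = (mx3 [:: [:: 1; 0; 0]; [:: 0; 0; 1]; [:: 0; 1; 0]])%R /\
      rho alpha2 = (mx3 [:: [:: 0; 1; 0]; [:: 1; 0; 0]; [:: 0; 0; 1]])%R].

(* Such a rho exists (rho_exists below): it is the symmetric square of the
   reduced Burau representation, obtained from Fox calculus.  fox_eps and
   fox_diff are the images under x_i |-> t of a word and of the row of its Fox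
   derivatives. *)
Section FoxCalculus.
Context (F : fieldType) (t : F) (t_neq0 : (t != 0)%R) (n : nat).
Local Open Scope ring_scope.
Implicit Types (l : letter n) (u v : FreeGroup n).

Definition eps_letter l : F := if l.2 then t^-1 else t.
Definition diff_letter l : 'rV[F]_n :=
  if l.2 then - t^-1 *: delta_mx 0 l.1 else delta_mx 0 l.1.
Definition eps_word (w : seq (letter n)) : F :=
  foldr (fun l e => eps_letter l * e) 1 w.
Definition diff_word (w : seq (letter n)) : 'rV[F]_n :=
  foldr (fun l d => diff_letter l + eps_letter l *: d) 0 w.
Definition fox_eps u := eps_word (val u).
Definition fox_diff u := diff_word (val u).

Lemma eps_letterV l : eps_letter l * eps_letter (linv l) = 1.
Proof. by case: l => i []; rewrite /eps_letter /= ?mulVf ?mulfV. Qed.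

Lemma diff_letterV l :
  diff_letter l + eps_letter l *: diff_letter (linv l) = 0.
Proof.
case: l => i []; rewrite /eps_letter /diff_letter /=.
  by rewrite -scalerDl addNr scale0r.
by rewrite scalerA mulrN mulfV // scaleN1r addrN.
Qed.

Lemma eps_push l w : eps_word (push l w) = eps_letter l * eps_word w.
Proof.
case: w => [|k w] //=; case: eqP => [->|//].
by rewrite mulrA eps_letterV mul1r.
Qed.

Lemma diff_push l w :
  diff_word (push l w) = diff_letter l + eps_letter l *: diff_word w.
Proof.
case: w => [|k w] //=; case: eqP => [->|//].
by rewrite scalerDr scalerA eps_letterV scale1r addrA diff_letterV add0r.
Qed.

Lemma fox_epsM : {morph fox_eps : u v / (u * v)%g >-> u * v}.
Proof.
move=> [u ru] [v rv]; rewrite /fox_eps /= => {ru rv}.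
by elim: u => [|l u IHu] /=; rewrite ?mul1r // eps_push IHu mulrA.
Qed.

Lemma fox_diffM u v : fox_diff (u * v)%g = fox_diff u + fox_eps u *: fox_diff v.
Proof.
case: u v => [u ru] [v rv]; rewrite /fox_eps /fox_diff /= => {ru rv}.
elim: u => [|l u IHu] /=; first by rewrite scale1r add0r.
by rewrite diff_push IHu scalerDr addrA scalerA.
Qed.

Lemma fox_eps1 : fox_eps 1%g = 1. Proof. by []. Qed.
Lemma fox_diff1 : fox_diff 1%g = 0. Proof. by []. Qed.
Lemma fox_eps_gen i : fox_eps (fgen i) = t. Proof. exact: mulr1. Qed.
Lemma fox_diff_gen i : fox_diff (fgen i) = delta_mx 0 i.
Proof. by rewrite /fox_diff /= scaler0 addr0. Qed.

Lemma fox_epsV u : fox_eps u^-1%g * fox_eps u = 1.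
Proof. by rewrite -fox_epsM mulVg. Qed.

Lemma fox_diffV u : fox_diff u^-1%g = - (fox_eps u^-1%g *: fox_diff u).
Proof. by apply/eqP; rewrite -addr_eq0 -fox_diffM mulVg. Qed.

Lemma fox_eps_aut (phi : ConjAut n) u : fox_eps (val (val phi) u) = fox_eps u.
Proof.
have [_ phiM] := autP (val phi); have /asboolP[p [f phiE]] := valP phi.
have phi_gen i : fox_eps (val (val phi) (fgen i)) = t.
  by rewrite phiE !fox_epsM fox_eps_gen mulrAC fox_epsV mul1r.
elim/fg_ind: u => [|i b u IHu]; first by rewrite (morph_group1 phiM).
rewrite phiM !fox_epsM IHu; congr (_ * _).
case: b; last by rewrite phi_gen fox_eps_gen.
rewrite (morph_groupV phiM); apply: (mulIf t_neq0).
have := fox_epsV (val (val phi) (fgen i)); rewrite phi_gen => ->.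
by have := fox_epsV (fgen i); rewrite fox_eps_gen => ->.
Qed.

Definition jacobian (phi : ConjAut n) : 'M[F]_n :=
  \matrix_i fox_diff (val (val phi) (fgen i)).

Lemma fox_diff_aut (phi : ConjAut n) u :
  fox_diff (val (val phi) u) = fox_diff u *m jacobian phi.
Proof.
have [_ phiM] := autP (val phi).
have phi_gen i : fox_diff (val (val phi) (fgen i))
    = fox_diff (fgen i) *m jacobian phi.
  by rewrite fox_diff_gen -rowE rowK.
elim/fg_ind: u => [|i b u IHu]; first by rewrite (morph_group1 phiM) mul0mx.
rewrite phiM !fox_diffM IHu mulmxDl -scalemxAl fox_eps_aut; congr (_ + _).
case: b; last exact: phi_gen.
rewrite (morph_groupV phiM) !fox_diffV phi_gen mulNmx -scalemxAl.
by rewrite -(morph_groupV phiM) fox_eps_aut.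
Qed.

Lemma jacobianM (phi psi : ConjAut n) :
  jacobian (phi * psi)%g = jacobian psi *m jacobian phi.
Proof.
apply/row_matrixP => i; rewrite row_mul !rowK /=.
by rewrite fox_diff_aut.
Qed.

Lemma jacobian1 : jacobian 1%g = 1%:M.
Proof. by apply/row_matrixP => i; rewrite rowK fox_diff_gen row1. Qed.

Lemma fox_fundamental u :
  (t - 1) *: (fox_diff u *m const_mx 1) = (fox_eps u - 1)%:M :> 'M_1.
Proof.
elim/fg_ind: u => [|i b u IHu].
  by rewrite fox_diff1 fox_eps1 mul0mx scaler0 subrr; apply/matrixP=> i j; rewrite !mxE mul0rn.
have genE : fox_diff (fgen i) *m const_mx 1 = 1%:M :> 'M[F]_1.
  rewrite fox_diff_gen -rowE; apply/matrixP => j k.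
  by rewrite !mxE !ord1 eqxx.
rewrite fox_diffM fox_epsM mulmxDl -scalemxAl scalerDr.
rewrite [_ *: (fox_eps _ *: _)]scalerA (mulrC (t - 1)) -scalerA IHu scale_scalar_mx.
suff -> : (t - 1) *: (fox_diff (if b then (fgen i)^-1 else fgen i)%g *m const_mx 1)
   = (fox_eps (if b then (fgen i)^-1 else fgen i)%g - 1)%:M :> 'M_1.
  by rewrite -raddfD /=; congr (_%:M); ring.
case: b; last by rewrite genE fox_eps_gen scale_scalar_mx mulr1.
rewrite fox_diffV mulNmx -scalemxAl genE scalerN scalerA scale_scalar_mx mulr1.
rewrite -raddfN /=; congr (_%:M).
have := fox_epsV (fgen i); rewrite fox_eps_gen.
by move=> e1; rewrite mulrBl mul1r mulrC e1 opprB.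
Qed.

Lemma jacobian_row_sum (phi : ConjAut n) :
  jacobian phi *m const_mx 1 = const_mx 1 :> 'cV_n.
Proof.
have /asboolP[p [f phiE]] := valP phi.
apply/row_matrixP => i; rewrite row_mul rowK phiE !fox_diffM fox_diffV fox_diff_gen.
rewrite !fox_epsM fox_eps_gen !mulmxDl mulNmx -!scalemxAl -rowE.
set d := fox_diff (f i) *m _; set e := fox_eps (f i)^-1%g.
have eE : e * fox_eps (f i) = 1 by exact: fox_epsV.
have : (t - 1) *: d = (fox_eps (f i) - 1)%:M by exact: fox_fundamental.
move: e eE d => e eE d; clear -eE => /matrixP/(_ ord0 ord0).
rewrite !mxE /= => dE; apply/matrixP => j k; rewrite !ord1 !mxE.
have -> : - (e * d ord0 ord0) + e * 1 + e * t * d ord0 ord0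
  = e * ((t - 1) * d ord0 ord0) + e by ring.
by rewrite dE mulr1n mulrBr eE mulr1 subrK.
Qed.

End FoxCalculus.

(* On vectors with coordinate sum 0, (sum_i d_i e_i)^2 is the combination of the
   squares (e_k - e_l)^2, k < l, with coefficients - d_k d_l.  Index p : 'I_3
   stands for the p-th of the pairs (k, l) = (0, 1), (0, 2), (1, 2). *)
Definition pair3 (p : 'I_3) : 'I_3 * 'I_3 :=
  nth (ord3_0, ord3_0)
    [:: (ord3_0, ord3_1); (ord3_0, ord3_2); (ord3_1, ord3_2)] p.

Definition sym2_mx (F : fieldType) (M : 'M[F]_3) : 'M[F]_3 :=
  (\matrix_(p, r) let d := row (pair3 p).1 M - row (pair3 p).2 M in
     - (d ord0 (pair3 r).1 * d ord0 (pair3 r).2))%R.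

Section RhoExists.
Context (F : fieldType) (q : F) (q_neq0 : (q != 0)%R).
Local Open Scope ring_scope.

Lemma ord3P (P : 'I_3 -> Prop) : P ord3_0 -> P ord3_1 -> P ord3_2 -> forall i, P i.
Proof.
by move=> P0 P1 P2 [[|[|[|//]]] lti]; rewrite (bool_irrelevance lti isT).
Qed.

Lemma sum3E (f : 'I_3 -> F) : \sum_i f i = f ord3_0 + f ord3_1 + f ord3_2.
Proof.
rewrite !big_ord_recl big_ord0 addr0 addrA.
by congr (f _ + f _ + f _); apply: val_inj.
Qed.

Lemma sym2_mxM (M N : 'M[F]_3) : M *m const_mx 1 = const_mx 1 :> 'cV_3 ->
  sym2_mx (M *m N) = sym2_mx M *m sym2_mx N.
Proof.
move=> /colP M1.
have M2 i : M i ord3_2 = 1 - M i ord3_0 - M i ord3_1.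
  have := M1 i; rewrite !mxE sum3E !mxE !mulr1 => <-; ring.
apply/matrixP => p r; rewrite !mxE sum3E !mxE /= !mxE !sum3E !M2.
by move: p; apply: ord3P => /=; ring.
Qed.

Lemma sym2_mx1 : sym2_mx 1%:M = 1%:M :> 'M[F]_3.
Proof.
apply/matrixP => p r; rewrite !mxE /= !mxE.
by move: p; apply: ord3P; move: r; apply: ord3P => /=; ring.
Qed.

Definition burau_sym2 (phi : C3) : 'M[F]_3 := sym2_mx (jacobian q phi^-1%g).

Lemma burau_sym2E (phi : C3) (M : 'M[F]_3) :
  jacobian q phi *m M = 1%:M -> burau_sym2 phi = sym2_mx M.
Proof.
move=> JM; congr (sym2_mx _).
rewrite -[LHS]mulmx1 -JM mulmxA -(jacobianM q_neq0) mulgV.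
by rewrite jacobian1 mul1mx.
Qed.

Lemma rho_exists : exists rho : C3 -> 'M[F]_3, is_rho q rho.
Proof.
pose mE := (fox_diffM q_neq0, fox_diffV q_neq0, fox_epsM q_neq0, fox_diff_gen,
  fox_eps_gen, sigma_imgE, alpha_imgE, fg_lift_gen).
have epsV i : fox_eps q (fgen i : FreeGroup 3)^-1%g = q^-1.
  have := fox_epsV q_neq0 (fgen i : FreeGroup 3); rewrite fox_eps_gen.
  by move=> e; apply: (mulIf q_neq0); rewrite e mulVf.
have value (phi : C3) (M N : 'M[F]_3) :
    jacobian q phi *m M = 1%:M -> sym2_mx M = N -> burau_sym2 phi = N.
  by move=> /burau_sym2E -> .
exists burau_sym2; split; [ | |
  apply: (value _ (mx3 [:: [:: 1 - q; q; 0]; [:: 1; 0; 0]; [:: 0; 0; 1]])) |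
  apply: (value _ (mx3 [:: [:: 1; 0; 0]; [:: 0; 1 - q; q]; [:: 0; 1; 0]])) |
  split; [
    apply: (value _ (mx3 [:: [:: 0; 1; 0]; [:: 1; 0; 0]; [:: 0; 0; 1]])) |
    apply: (value _ (mx3 [:: [:: 1; 0; 0]; [:: 0; 0; 1]; [:: 0; 1; 0]])) ] ];
  first by rewrite /burau_sym2 invg1 jacobian1 sym2_mx1.
  move=> phi psi; rewrite /burau_sym2 invgM (jacobianM q_neq0).
  by rewrite sym2_mxM // jacobian_row_sum.
all: apply/matrixP => i j; rewrite !mxE ?sum3E ?mxE /= ?mE ?mxE.
all: move: i; apply: ord3P => /=; rewrite ?mE ?epsV ?mxE.
all: by move: j; apply: ord3P => /=; field.
Qed.

End RhoExists.

(* Main.v *)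
(** The matrix [rho T] squares to the scalar [q ^ 2], so even powers of [T] are
    central under [rho].  If [A_r A_1 = 1], conjugating [x] by [A_1 T] brings
    the two outer occurrences of [T] together and thus turns [x] into the same
    expression on [A_2, ..., A_(r-1)].  If [A_r A_1 = A_2 = ... = A_(r-1)], then
    conjugating by [A_1 T] gives [(A_2 T)^(r-1) T^(1-r)] directly.  Cases (b)
    and (c) peel off pairs until one letter, respectively case (a), is left. *)
Require Import Defs.
From mathcomp Require Import all_boot all_fingroup all_algebra.
From mathcomp Require Import boolp reals ring zify.
From mathcomp.real_closed Require Import complex.

Local Open Scope group_scope.

Lemma rho_T2 (F : fieldType) (q : F) (rho : C3 -> 'M[F]_3) :
  is_rho q rho -> rho (T ^+ 2) = ((q ^+ 2)%:M)%R.
Proof.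
case=> _ rhoM _ s2E [a1E a2E].
rewrite expg2 /T !rhoM s2E a1E a2E.
apply/matrixP => i j; rewrite !(mxE, sum3E) /=.
by move: i; apply: ord3P; move: j; apply: ord3P => /=; ring.
Qed.

Section AlternatingProducts.
Context {G : groupType} {S : pzRingType} {rho : G -> S} {t : G}.
Hypothesis rhoM : {morph rho : x y / x * y >-> (x * y)%R}.
Hypothesis t2_central : forall g, rho (t ^+ 2 * g) = rho (g * t ^+ 2).

Definition rho_conj (x y : G) := exists w, rho (w^-1 * x * w) = rho y.

Lemma rho_conj_trans x y z : rho_conj x y -> rho_conj y z -> rho_conj x z.
Proof.
move=> [v vE] [w wE]; exists (v * w).
have -> : (v * w)^-1 * x * (v * w) = w^-1 * (v^-1 * x * v) * w.
  by rewrite invgM !mulgA.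
by rewrite !(rhoM _ w) (rhoM w^-1) vE -!rhoM.
Qed.

Lemma rho_even_expg_central m g : rho (t ^+ m.*2 * g) = rho (g * t ^+ m.*2).
Proof.
rewrite -mul2n expgM; move: (t ^+ 2) t2_central => z z_central.
elim: m g => [|m IHm] g; first by rewrite mulg1 mul1g.
by rewrite expgS -mulgA z_central -mulgA IHm mulgA.
Qed.

(** Centrality is known for positive powers only. Inserting [t ^+ m.*2 * t ^- m.*2] after [g] lets
    the positive power move left past [g] and cancel. *)
Lemma rho_even_expgV_central m u g :
  rho (u * t ^- m.*2 * g) = rho (u * g * t ^- m.*2).
Proof.
have -> : u * t ^- m.*2 * g = u * (t ^- m.*2 * (g * t ^+ m.*2)) * t ^- m.*2.
  by rewrite !mulgA mulgK.
rewrite (rhoM _ (t ^- _)) (rhoM u) (rhoM (t ^- _)) -rho_even_expg_central.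
by rewrite -rhoM mulKg -!rhoM.
Qed.

Lemma rho_conj_expgV m u v w :
  rho (w^-1 * u * w * t ^- m.*2) = rho v -> rho_conj (u * t ^- m.*2) v.
Proof. by move=> uv; exists w; rewrite -uv mulgA rho_even_expgV_central. Qed.

(** The first form of [x] on the [m.*2.+1] letters [a k], ..., [a (k + m.*2)]. Their number is odd,
    so the power of [t] is even. *)
Definition alt_prod (a : nat -> G) k m :=
  (\prod_(k <= i < k + m.*2) (a i * t)) * a (k + m.*2) * t ^- m.*2.

Lemma alt_prod_peel1 a k m : a (k + m.+1.*2) * a k = 1 ->
  rho_conj (alt_prod a k m.+1) (alt_prod a k.+1 m).
Proof.
move=> ak1; apply: (@rho_conj_expgV _ _ _ (a k * t)).
have eqk : k + m.+1.*2 = (k.+1 + m.*2).+1 by lia.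
rewrite eqk in ak1; rewrite eqk.
rewrite big_ltn; last by rewrite -addnS leq_addr.
rewrite big_nat_recr; last by rewrite leq_addr.
rewrite invgM -!mulgA !mulKg (mulgA _ (a k)) ak1 mul1g.
congr rho; rewrite /alt_prod -mulgA; do 2!congr (_ * _).
(* The word now ends in [t * t], which absorbs two of the [m.+1.*2] inverse factors. *)
by rewrite doubleS !(expgSr _ _.+1) (expgSr _ m.*2) !invgM !mulVKg.
Qed.

Lemma alt_prod_peel a n k m :
  (forall j, (j < n)%N -> a (k + (n + m).*2 - j) * a (k + j) = 1) ->
  rho_conj (alt_prod a k (n + m)) (alt_prod a (k + n) m).
Proof.
elim: n k => [|n IHn] k ak1; first by exists 1; rewrite invg1 mul1g mulg1 addn0.
apply: rho_conj_trans (_ : rho_conj (alt_prod a k.+1 (n + m)) _).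
  by apply: alt_prod_peel1; have := ak1 0 isT; rewrite subn0 addn0.
rewrite -addSnnS; apply: IHn => j ltjn.
by have := ak1 j.+1 ltjn; congr (a _ * a _ = 1); lia.
Qed.

(** Conjugation by [a k * t] drops the first factor and turns the last letter into
    [a (k + m.+1.*2) * a k * t = c * t], so all [m.+1.*2] factors equal [c * t]. *)
Lemma alt_prod_const a k m c :
  a (k + m.+1.*2) * a k = c ->
  (forall i, (k < i < k + m.+1.*2)%N -> a i = c) ->
  rho_conj (alt_prod a k m.+1) ((c * t) ^+ m.+1.*2 * t ^- m.+1.*2).
Proof.
move=> akc aic; apply: (@rho_conj_expgV _ _ _ (a k * t)).
rewrite big_ltn; last by lia.
rewrite (eq_big_nat _ _ (F2 := fun=> c * t)); last first.
  by move=> i ltki; rewrite aic //; lia.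
rewrite prodg_const_nat.
have -> : (k + m.+1.*2 - k.+1 = m.*2.+1)%N by lia.
rewrite invgM -!mulgA !mulKg (mulgA _ (a k)) akc !mulgA.
by rewrite -(mulgA _ c) -expgSr.
Qed.

End AlternatingProducts.

Theorem proposition9 (R : realType) (q : R[i]) (q_neq0 : (q != 0)%R)
    (rho : C3 -> 'M[R[i]]_3) (rhoP : is_rho q rho)
    (r : nat) (r_ge3 : (3 <= r)%N) (r_odd : odd r)
    (A : nat -> word)
    (A_alpha : forall i, (1 <= i <= r)%N -> alpha_word (A i))
    (A_even : ~~ odd (\sum_(1 <= i < r.+1) word_length (A i))%N)
    (x : C3)
    (xE : let P := (\prod_(1 <= i < r) (word_val (A i) * T)) * word_val (A r) in
          x = P * T ^- r.-1 \/ x = T ^- r.-1 * P)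
    (habc :
      (* (a) *)
      (forall i, (2 <= i <= r.-1)%N ->
         word_val (A r) * word_val (A 1%N) = word_val (A i))
      \/
      (* (b) *)
      (forall i, (1 <= i <= r.-1./2)%N ->
         word_val (A (r.+1 - i)%N) * word_val (A i) = 1)
      \/
      (* (c) *)
      (exists i : nat, [/\ (i.*2 + 5 <= r)%N,
         forall j, (1 <= j <= i.+1)%N ->
           word_val (A (r.+1 - j)%N) * word_val (A j) = 1
       & forall j, (i + 3 <= j <= r - i - 2)%N ->
           word_val (A (r - i - 1)%N) * word_val (A (i + 2)%N)
           = word_val (A j)])) :
  exists (w : C3) (B : word) (s : nat),
    [/\ alpha_word B, (1 <= s)%N
      & rho (w^-1 * x * w) = rho ((word_val B * T) ^+ s * T ^- s)].
Proof.
have [_ rhoM _ _ _] := rhoP.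
have T2_central g : rho (T ^+ 2 * g) = rho (g * T ^+ 2).
  by rewrite (rhoM g) (rhoM (T ^+ 2)) (rho_T2 _ _ _ rhoP) scalar_mxC.
have [m rE] : exists m, r = m.+1.*2.+1 by exists (r.-1./2.-1); lia.
pose a i := word_val (A i).
have x_alt : rho x = rho (alt_prod (t := T) a 1 m.+1).
  case: xE => ->; rewrite /alt_prod rE //.
  (* The exponent [r.-1] is even, so the two forms of [x] have the same image. *)
  by rewrite -[T ^- _]mul1g (rho_even_expgV_central rhoM T2_central) !mul1g.
suff [B [s [B_alpha s_gt0 [w wE]]]] : exists B s,
    [/\ alpha_word B, (0 < s)%N & rho_conj (rho := rho)
      (alt_prod (t := T) a 1 m.+1) ((word_val B * T) ^+ s * T ^- s)].
  by exists w, B, s; split=> //; rewrite -wE !(rhoM _ w) !(rhoM w^-1) x_alt.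
case: habc => [abc|[abc|[i [ltir abc1 abc2]]]].
- exists (A 2), m.+1.*2; split=> //; first by apply: A_alpha; lia.
  apply: (alt_prod_const rhoM T2_central) => [|i lti].
    by rewrite -[RHS]abc /a ?rE //; lia.
  by rewrite /a -abc; [apply: abc|]; lia.
(* Peeling [m.+1] pairs leaves only the middle letter, of index [(r + 1) / 2]. *)
- exists (A m.+2), 1%N; split=> //; first by apply: A_alpha; lia.
  have -> : (word_val (A m.+2) * T) ^+ 1 * T ^- 1 = alt_prod (t := T) a (1 + m.+1) 0.
    by rewrite /alt_prod addn0 big_geq // mul1g invg1 mulg1 mulgK.
  have := alt_prod_peel rhoM T2_central a m.+1 1 0; rewrite !addn0; apply=> j ltj.
  by rewrite /a -(abc j.+1) ?rE; [congr (word_val (A _) * _)|]; lia.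
(* After [i.+1] pairs the letters [i + 2], ..., [r - i - 1] remain, [n.+1.*2.+1] in number. As
   [i.*2 + 5 <= r], there are at least three, so [A (i + 3)] is an inner one. *)
- have [n mE] : exists n, m.+1 = (i.+1 + n.+1)%N by exists (m - i.+1); lia.
  exists (A (i + 3)), n.+1.*2; split=> //; first by apply: A_alpha; lia.
  apply: rho_conj_trans (_ : rho_conj (alt_prod a (1 + i.+1) n.+1) _) => //.
    rewrite mE; apply: (alt_prod_peel rhoM T2_central) => j ltj.
    by rewrite /a -(abc1 j.+1) ?rE; [congr (word_val (A _) * _)|]; lia.
  have aE j : (i + 3 <= j <= i + n.*2 + 3)%N -> a j = a (r - i - 1)%N * a (i + 2)%N.
    by move=> ltj; apply/esym/abc2; lia.
  apply: (alt_prod_const rhoM T2_central) => [|j ltj].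
    by rewrite -[RHS]/(a _) [RHS]aE; [congr (a _ * a _)|]; lia.
  by rewrite -[RHS]/(a _) (aE j) ?(aE (i + 3)) //; lia.
Qed.
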